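(* For every integer $t\geq 1$, the number $sm_{\vec{\chi}}(t)$ (exists and) satisfies $$sm_{\vec{\chi}}(t)\le 2m_\chi(t)-1.$$
   Context: All graphs and digraphs are finite; undirected graphs are simple, digraphs have no loops and no parallel arcs, but may contain both arcs $(u,v)$ and $(v,u)$. For an undirected graph $G$, $\chi(G)$ is its chromatic number. For a digraph $D$, the dichromatic number $\vec{\chi}(D)$ is the minimum $k$ such that $V(D)$ can be colored with $k$ colors so that every color class induces an acyclic subdigraph (one without directed cycles; two opposite arcs between the same two vertices form a directed cycle of length 2). For an undirected graph $G$, $\overleftrightarrow{G}$ is the digraph on $V(G)$ in which every edge $uv\in E(G)$ is replaced by the two arcs $(u,v)$ and $(v,u)$. $K_t$ is the complete graph on $t$ vertices. A digraph $D$ is a strong $H$-minor model, for a digraph $H$, if $V(D)$ can be partitioned into non-empty sets $\{X_v : v\in V(H)\}$ (branch sets) such that the induced subdigraph $D[X_v]$ is strongly connected for every $v\in V(H)$, and for every arc $(u,v)$ of $H$ there is an arc in $D$ from $X_u$ to $X_v$. A digraph $D$ contains $H$ as a strong minor if some subdigraph of $D$ is a strong $H$-minor model. $m_\chi(t)$ is the least positive integer such that every undirected graph with chromatic number at least $m_\chi(t)$ contains $K_t$ as a minor (it is well known that $m_\chi(t)$ is finite for every $t\ge 1$). $sm_{\vec{\chi}}(t)$ is the least positive integer such that every digraph $D$ with $\vec{\chi}(D)\ge sm_{\vec{\chi}}(t)$ contains $\overleftrightarrow{K}_t$ as a strong minor. *)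

(* Defs.v *)
From mathcomp Require Import boolp.
From mathcomp Require Import all_boot.

Set Implicit Arguments.
Unset Strict Implicit.
Unset Printing Implicit Defensive.

Record sgraph := SGraph {
  svertex :> finType;
  edge : rel svertex;
  edge_sym : symmetric edge;
  edge_irr : irreflexive edge }.

Record digraph := DiGraph {
  dvertex :> finType;
  darc : rel dvertex;
  darc_irr : irreflexive darc }.

Section Induced.

Variables (G : sgraph) (A : {set G}) (D : digraph) (B : {set D}).

Definition induced_edge : rel {x : G | x \in A} :=
  [rel x y | edge (val x) (val y)].

Fact induced_edge_sym : symmetric induced_edge.
Proof. by move=> x y; exact: edge_sym. Qed.

Fact induced_edge_irr : irreflexive induced_edge.
Proof. by move=> x; exact: edge_irr. Qed.

Definition sinduced : sgraph := SGraph induced_edge_sym induced_edge_irr.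

Definition induced_arc : rel {x : D | x \in B} :=
  [rel x y | darc (val x) (val y)].

Fact induced_arc_irr : irreflexive induced_arc.
Proof. by move=> x; exact: darc_irr. Qed.

Definition dinduced : digraph := DiGraph induced_arc_irr.

End Induced.

Definition Kedge t : rel 'I_t := [rel x y | x != y].

Fact Kedge_sym t : symmetric (@Kedge t).
Proof. by move=> x y; rewrite /Kedge /= eq_sym. Qed.

Fact Kedge_irr t : irreflexive (@Kedge t).
Proof. by move=> x; rewrite /Kedge /= eqxx. Qed.

Definition complete t : sgraph := SGraph (@Kedge_sym t) (@Kedge_irr t).

Definition bidirected (G : sgraph) : digraph := DiGraph (@edge_irr G).

Definition colorable (G : sgraph) (k : nat) : Prop :=
  exists f : G -> 'I_k, forall x y : G, edge x y -> f x != f y.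

Fact colorable_ex (G : sgraph) : exists k, `[< colorable G k >].
Proof.
exists #|G|; apply/asboolP; exists enum_rank => x y xy.
by apply/eqP => /enum_rank_inj exy; rewrite exy edge_irr in xy.
Qed.

Definition chromatic_number (G : sgraph) : nat := ex_minn (colorable_ex G).

(* There are no loops, so a nonempty [ucycle] has length at least 2; two
   opposite arcs form one of length exactly 2. *)
Definition acyclic (D : digraph) : Prop :=
  forall c : seq D, ucycle (@darc D) c -> c = [::].

Definition dicolorable (D : digraph) (k : nat) : Prop :=
  exists f : D -> 'I_k,
    forall i : 'I_k, acyclic (dinduced [set x | f x == i]).

Fact dicolorable_ex (D : digraph) : exists k, `[< dicolorable D k >].
Proof.
exists #|D|; apply/asboolP; exists enum_rank => i [|x c] //=.
have inj (y z : dinduced [set x | enum_rank x == i]) : y = z.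
  apply/val_inj/enum_rank_inj.
  by have:= valP y; have:= valP z; rewrite !inE => /eqP -> /eqP ->.
case: c => [|y c] /andP[].
  by rewrite /= induced_arc_irr.
by rewrite /= (inj y x) induced_arc_irr.
Qed.

Definition dichromatic_number (D : digraph) : nat :=
  ex_minn (dicolorable_ex D).

Definition connected (G : sgraph) : Prop :=
  forall x y : G, connect (@edge G) x y.

Definition strongly_connected (D : digraph) : Prop :=
  forall x y : D, connect (@darc D) x y.

Definition contains_minor (G H : sgraph) : Prop :=
  exists X : H -> {set G},
    [/\ forall v, X v != set0,
        forall u v, u != v -> [disjoint X u & X v],
        forall v, connected (sinduced (X v)) &
        forall u v, edge u v ->
          exists x y, [/\ x \in X u, y \in X v & edge x y]].

Definition strong_minor_model (D H : digraph) : Prop :=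
  exists X : H -> {set D},
    [/\ [/\ forall v, X v != set0,
            forall u v, u != v -> [disjoint X u & X v] &
            \bigcup_v X v = setT],
        forall v, strongly_connected (dinduced (X v)) &
        forall u v, darc u v ->
          exists x y, [/\ x \in X u, y \in X v & darc x y]].

(* Subdigraphs, not necessarily induced, are taken up to isomorphism. *)
Definition subdigraph (D' D : digraph) : Prop :=
  exists2 f : D' -> D, injective f & forall x y, darc x y -> darc (f x) (f y).

Definition contains_strong_minor (D H : digraph) : Prop :=
  exists2 D' : digraph, subdigraph D' D & strong_minor_model D' H.

Definition least_positive (P : nat -> Prop) (n : nat) : Prop :=
  [/\ 0 < n, P n & forall m, 0 < m -> P m -> n <= m].

(* [is_m_chi t m] says that m_chi(t) exists and equals m; likewise below. *)
Definition is_m_chi (t m : nat) : Prop :=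
  least_positive (fun n => forall G : sgraph,
    n <= chromatic_number G -> contains_minor G (complete t)) m.

Definition is_sm_dichi (t s : nat) : Prop :=
  least_positive (fun n => forall D : digraph,
    n <= dichromatic_number D ->
    contains_strong_minor D (bidirected (complete t))) s.

(* Main.v *)
Require Import Defs.
From mathcomp Require Import boolp.
From mathcomp Require Import all_boot.
From mathcomp Require Import zify.

Set Implicit Arguments.
Unset Strict Implicit.
Unset Printing Implicit Defensive.

(** Call a nonempty vertex set good if it induces a strongly connected,
    2-dicolorable subdigraph. Partition V(D) into blocks by repeatedly removing
    a maximal good set, and join two blocks by an edge of an undirected graph H
    when there are arcs between them in both directions. If a monochromatic
    directed cycle met several pairwise non-adjacent blocks, the earliest of
    them, B, would have an ear inside the union of the blocks met; the inner
    vertices of a shortest ear, colored alternately, would enlarge B to a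
    bigger good set. Hence independent sets of blocks span 2-dicolorable
    subdigraphs, the dichromatic number of D is at most 2 chi(H), and a K_t
    minor of H yields a strong minor of D because blocks are strongly connected.

    That m_chi(t+1) exists, with m_chi(t+1) <= 2^t + 1, is the breadth-first
    argument: in a connected graph of chromatic number greater than 2k some
    distance layer has chromatic number greater than k, and the ball inside that
    layer is a connected set adjacent to each of its vertices. *)

(** * Strongly connected vertex sets and acyclicity inside a set *)

Section StrongSets.

Variables (T : finType) (e : rel T).

(** Restricting the relation rather than the type lets different vertex sets be compared and united
    inside one type [T]. *)
Definition restr (A : {set T}) (x y : T) : bool :=
  [&& x \in A, y \in A & e x y].

Arguments restr A x y /.

Definition strong (A : {set T}) : Prop :=
  {in A &, forall x y, connect (restr A) x y}.

Lemma connect_restrS (A B : {set T}) x y :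
  A \subset B -> connect (restr A) x y -> connect (restr B) x y.
Proof.
move=> /subsetP sAB; apply: connect_sub => u v /and3P[uA vA uv].
by apply: connect1; rewrite /= !sAB.
Qed.

Lemma connect_restr_in (A : {set T}) x y :
  x \in A -> connect (restr A) x y -> y \in A.
Proof.
move=> xA /connectP[s]; elim: s x xA => [|z s IHs] x xA /=; first by move=> _ ->.
by case/andP=> /and3P[_ zA _]; exact: IHs.
Qed.

Lemma strong1 x : strong [set x].
Proof. by move=> y z; rewrite !inE => /eqP-> /eqP->; exact: connect0. Qed.

Lemma strong_hub (A : {set T}) b :
  (forall x, x \in A -> connect (restr A) b x /\ connect (restr A) x b) ->
  strong A.
Proof.
by move=> hub x y /hub[_ xb] /hub[+ _]; exact: connect_trans.
Qed.

(** A path in [A] between two vertices of the component never leaves it: each vertex on it is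
    reached from [x] and reaches [x] through the end of the path. *)
Lemma strong_component (A : {set T}) x :
  strong [set z in A | connect (restr A) x z && connect (restr A) z x].
Proof.
set C := [set z in A | _] => u v uC vC.
have: connect (restr A) u v.
  move: uC vC; rewrite !inE => /and3P[_ _ ux] /and3P[_ xv _].
  exact: connect_trans ux xv.
case/connectP=> s; elim: s u uC => [|w s IHs] u uC /=.
  by move=> _ ->; exact: connect0.
case/andP=> uw ws Dv; have /and3P[uA wA euw] := uw.
have cuw : connect (restr A) u w by exact: connect1.
have wC: w \in C.
  move: uC vC; rewrite !inE wA => /and3P[_ xu _] /and3P[_ _ vx] /=.
  rewrite (connect_trans xu cuw) /=.
  by apply: connect_trans vx; apply/connectP; exists s.
apply: connect_trans (IHs w wC ws Dv).
by apply: connect1; rewrite /= uC wC.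
Qed.

(** A walk between indices expands to a walk between vertices: move inside [F i] to the tail of an
    arc into the next set, cross it, and continue. This will make the union of the blocks in a
    branch set strong. *)
Lemma strong_bigcup (I : finType) (r : rel I) (J : {set I}) (F : I -> {set T}) :
    (forall i j, i \in J -> j \in J ->
       connect [rel i j | [&& i \in J, j \in J & r i j]] i j) ->
    (forall i, i \in J -> strong (F i)) ->
    (forall i j, r i j -> exists x y, [/\ x \in F i, y \in F j & e x y]) ->
  strong (\bigcup_(i in J) F i).
Proof.
move=> conJ strF arcF x y /bigcupP[i iJ xi] /bigcupP[j jJ yj].
set U := \bigcup_(i in J) F i.
have sFU k : k \in J -> F k \subset U by move=> kJ; exact: bigcup_sup.
have /connectP[s] := conJ i j iJ jJ.
elim: s i iJ x xi => [|k s IHs] i iJ x xi /=.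
  move=> _ Dj; move: yj; rewrite Dj => yi.
  by apply: connect_restrS (sFU i iJ) _; exact: strF.
case/andP=> /and3P[_ kJ /arcF[a [b [ai bk eab]]]] ks Dj.
apply: connect_trans (IHs k kJ b bk ks Dj).
apply: (@connect_trans _ _ a).
  by apply: connect_restrS (sFU i iJ) _; exact: strF.
by apply: connect1; rewrite /= (subsetP (sFU i iJ)) // (subsetP (sFU k kJ)).
Qed.

Lemma connect_lift (U : finType) (g : U -> T) (A : {set T}) :
    injective g -> (forall x, x \in A -> exists u, g u = x) ->
  forall u v, connect (restr A) (g u) (g v) ->
  connect [rel a b | e (g a) (g b)] u v.
Proof.
move=> inj_g surj_g u v /connectP[s].
elim: s u => [|x s IHs] u /=; first by move=> _ /inj_g->; exact: connect0.
case/andP=> /and3P[_ xA ux] xs Dv; have [w Dw] := surj_g x xA.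
move: ux xs Dv; rewrite -Dw => uw ws Dv.
by apply: connect_trans (IHs w ws Dv); exact: connect1.
Qed.

Lemma connect_restr_val (A : {set T}) (a b : {x : T | x \in A}) :
  connect [rel x y : {x : T | x \in A} | e (val x) (val y)] a b ->
  connect (restr A) (val a) (val b).
Proof.
case/connectP=> s; elim: s a => [|c s IHs] a /=.
  by move=> _ ->; exact: connect0.
case/andP=> ac cs Db; apply: connect_trans (IHs c cs Db).
by apply: connect1; rewrite /= (valP a) (valP c).
Qed.

Lemma path_first_entry (r : rel T) (B : {set T}) x s :
    path r x s -> x \notin B -> last x s \in B ->
  exists s', [/\ path r x s', all [predC B] (x :: s') &
                 exists2 b, b \in B & r (last x s') b].
Proof.
elim: s x => [|y s IHs] x /=; first by move=> _ /negPf->.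
case/andP=> xy ys xB lB; have [yB|yB] := boolP (y \in B).
  by exists [::]; split=> //=; [rewrite xB | exists y].
have [s' [ys' aB bl]] := IHs y ys yB lB.
by exists (y :: s'); split=> //=; [rewrite xy | rewrite xB].
Qed.

Lemma path_exit (r : rel T) (B : {set T}) x s :
    path r x s -> x \in B -> last x s \notin B ->
  exists b y, [/\ b \in B, y \notin B & r b y].
Proof.
elim: s x => [|y s IHs] x /=; first by move=> _ ->.
case/andP=> xy ys xB lB; have [yB|yB] := boolP (y \in B); first exact: IHs ys yB lB.
by exists x, y.
Qed.

(* Acyclicity of the subdigraph induced on [A], certified by a rank function. *)
Definition acyc (A : {set T}) : Prop :=
  exists h : T -> nat, {in A &, forall x y, e x y -> h y < h x}.

Lemma acyc_path (A : {set T}) (h : T -> nat) x s :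
    {in A &, forall x y, e x y -> h y < h x} ->
  path (restr A) x s -> h (last x s) <= h x.
Proof.
move=> hA; elim: s x => //= y s IHs x /andP[/and3P[xA yA xy] /IHs/leq_trans->] //.
exact/ltnW/hA.
Qed.

Lemma strong_acyc (A : {set T}) x y :
  strong A -> acyc A -> x \in A -> y \in A -> x = y.
Proof.
move=> strA [h hA] xA yA; have /connectP[[|z s] /=] := strA x y xA yA.
  by move=> _ ->.
case/andP=> /and3P[_ zA xz] _ _; have /connectP[p zp Dx] := strA z x zA xA.
have := acyc_path hA zp; rewrite -Dx => le_xz.
by have := hA x z xA zA xz; rewrite ltnNge le_xz.
Qed.

Lemma acycS (A B : {set T}) : A \subset B -> acyc B -> acyc A.
Proof.
by move=> /subsetP sAB [h hB]; exists h => x y /sAB xB /sAB yB; exact: hB.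
Qed.

Hypothesis e_irr : irreflexive e.

(** The number of vertices reachable inside [A] is a rank: along an arc it drops strictly, unless
    the head reaches the tail again, and then both ends lie in one strong component. *)
Lemma acycPn (A : {set T}) : ~ acyc A ->
  exists C : {set T}, [/\ C \subset A, strong C &
    exists x y, [/\ x \in C, y \in C & x != y]].
Proof.
move=> NA; apply: contrapT => noC; apply: NA.
exists (fun x => #|[set y | connect (restr A) x y]|) => x y xA yA xy.
have xy1 : restr A x y by rewrite /= xA yA.
apply: proper_card; rewrite properE; apply/andP; split.
  apply/subsetP=> z; rewrite !inE; exact: connect_trans (connect1 xy1).
apply/negP=> /subsetP/(_ x); rewrite !inE connect0 => /(_ isT) yx.
apply: noC; exists [set z in A | connect (restr A) x z && connect (restr A) z x].
split; [by apply/subsetP=> z; rewrite inE => /andP[] | exact: strong_component |].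
exists x, y; rewrite !inE xA yA connect0 (connect1 xy1) yx; split=> //.
by apply: contraTneq xy => ->; rewrite e_irr.
Qed.

(** * Good sets and the greedy partition into blocks *)

Definition good (X : {set T}) : Prop :=
  [/\ X != set0, strong X &
      exists c : T -> bool, forall i, acyc [set x in X | c x == i]].

Definition max_good (S B : {set T}) : Prop :=
  [/\ good B, B \subset S &
      forall B' : {set T}, good B' -> B \subset B' -> B' \subset S -> B' \subset B].

Lemma good1 x : good [set x].
Proof.
split; first by apply/set0Pn; exists x; rewrite inE.
  exact: strong1.
exists xpredT => i; exists (fun=> 0) => y z; rewrite !inE.
by move=> /andP[/eqP-> _] /andP[/eqP-> _]; rewrite e_irr.
Qed.

Lemma max_good_exists (S : {set T}) : S != set0 -> exists B, max_good S B.
Proof.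
case/set0Pn=> x xS; pose P := [pred X : {set T} | `[< good X >] & X \subset S].
have Px : P [set x] by rewrite /= sub1set xS andbT; apply/asboolP; exact: good1.
have [B /maxsetP[/andP[/asboolP gB sBS] maxB] _] := maxset_exists Px.
exists B; split=> // B' gB' sBB' sB'S; rewrite (maxB B') //=.
by rewrite sB'S andbT; apply/asboolP.
Qed.

Lemma max_goodS (S S' B : {set T}) :
  max_good S B -> B \subset S' -> S' \subset S -> max_good S' B.
Proof.
case=> gB _ maxB sBS' sS'S; split=> // B' gB' sBB' sB'S'.
by apply: maxB => //; exact: subset_trans sS'S.
Qed.

(* In a subfamily [Q], the block that the greedy procedure removed first is
   maximal good within [cover Q]. *)
Lemma greedy_partition (S : {set T}) :
  exists P : {set {set T}}, partition P S /\
    forall Q : {set {set T}}, Q \subset P -> Q != set0 ->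
      exists2 B, B \in Q & max_good (cover Q) B.
Proof.
have [n] := ubnP #|S|; elim: n S => // n IHn S leSn.
have [->|ntS] := eqVneq S set0.
  exists set0; split; last by move=> Q; rewrite subset0 => /eqP-> /eqP.
  by rewrite partition_set0.
have [B maxB] := max_good_exists ntS; have [[ntB _ _] sBS _] := maxB.
have [|P [parP maxP]] := IHn (S :\: B).
  rewrite ltnS in leSn; apply: leq_trans leSn; apply: proper_card.
  rewrite properE subsetDl /=; have /set0Pn[x xB] := ntB.
  by apply/subsetPn; exists x; rewrite ?inE ?xB // (subsetP sBS).
have parBP : partition (B |: P) S.
  rewrite -(setID S B) (setIidPr sBS); apply: partitionU1 => //.
  by apply/pred0P=> x; rewrite /= !inE; case: (x \in B).
exists (B |: P); split=> // Q sQ ntQ.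
have [BQ|nBQ] := boolP (B \in Q).
  exists B => //; apply: (max_goodS maxB); first exact: bigcup_sup BQ.
  by rewrite -(cover_partition parBP); apply/bigcupsP=> X XQ;
    apply: bigcup_sup (subsetP sQ X XQ).
apply: maxP => //; apply/subsetP=> X XQ.
have /setU1P[DX|//] := subsetP sQ X XQ.
by rewrite -DX XQ in nBQ.
Qed.


(** * Shortest ears and the enlargement of a good set *)

Lemma path_restr (A : {set T}) x s :
  path e x s -> {subset x :: s <= A} -> path (restr A) x s.
Proof.
elim: s x => //= y s IHs x /andP[xy ys] sA.
rewrite !sA ?inE ?eqxx ?orbT //= xy IHs // => z zs.
by apply: sA; rewrite inE zs orbT.
Qed.

Lemma last_take x (s : seq T) i :
  i <= size s -> last x (take i s) = nth x (x :: s) i.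
Proof.
elim: s x i => [|y s IHs] x [|i] //= lei.
rewrite IHs //; exact: set_nth_default.
Qed.

Lemma path_shortcut (r : rel T) x s i j :
    i.+1 < j <= size s -> path r x s -> r (nth x (x :: s) i) (nth x (x :: s) j) ->
  exists s', [/\ path r x s', size s' < size s, last x s' = last x s
               & {subset s' <= s}].
Proof.
case: j => // j /andP[ltij ltjs] xs rij; rewrite ltnS in ltij.
exists (take i s ++ drop j s).
have lei : i <= size s by exact: leq_trans (ltnW ltij) (ltnW ltjs).
have Ds := drop_nth x ltjs.
split.
- have: path r x (take i s ++ drop i s) by rewrite cat_take_drop.
  rewrite !cat_path => /andP[-> _] /=; rewrite Ds /= last_take //.
  have: path r x (take j.+1 s ++ drop j.+1 s) by rewrite cat_take_drop.
  by rewrite cat_path last_take //= rij => /andP[].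
- by rewrite size_cat size_takel // size_drop; lia.
- by rewrite -{3}(cat_take_drop j s) !last_cat Ds.
- by move=> z; rewrite mem_cat => /orP[/mem_take|/mem_drop].
Qed.

Definition adj (A B : {set T}) : bool :=
  [exists x in A, exists y in B, e x y].

Lemma adjP (A B : {set T}) :
  reflect (exists x y, [/\ x \in A, y \in B & e x y]) (adj A B).
Proof.
apply: (iffP exists_inP) => [[x xA /exists_inP[y yB xy]]|[x [y [xA yB xy]]]].
  by exists x, y.
by exists x => //; apply/exists_inP; exists y.
Qed.

(** If [C] met [B] without lying in it, [B] would have an ear inside [cover Q]. On a shortest ear,
    [B] sends arcs only to the first inner vertex, that vertex sends none back, and no arc skips
    forward; so [B] with the ear is still 2-dicolorable, against maximality. *)
Lemma strong_sub_max_good (Q : {set {set T}}) (B C : {set T}) :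
    max_good (cover Q) B ->
    (forall B', B' \in Q -> B' != B -> ~~ (adj B B' && adj B' B)) ->
    C \subset cover Q -> strong C -> ~~ [disjoint B & C] ->
  C \subset B.
Proof.
set S := cover Q => -[[ntB strB [c acyB]] sBS maxB] nadj sCS strC.
case/pred0Pn=> b0 /andP[/= b0B b0C]; apply/subsetP=> z zC.
apply/contraT=> zB.
pose ear n := exists x p, [/\ size p = n, exists2 b, b \in B & e b x,
  path (restr S) x p, all [predC B] (x :: p) &
  x \in S /\ exists2 b, b \in B & e (last x p) b].
(* [ear] describes the inner vertices [x :: p] of a path from [B] to [B]. *)
have : exists n, `[< ear n >].
  have CS : subrel (restr C) (restr S).
    by move=> u v /and3P[uC vC uv]; rewrite /= !(subsetP sCS).
  (* Strong connectivity of [C] supplies the ear: leave [B] on the way from [b0] to [z], then go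
     back towards [b0] until just before the first return to [B]. *)
  have /connectP[s b0s Dz] := strC b0 z b0C zC; rewrite Dz in zB.
  have [b1 [y [b1B yB /and3P[_ yC b1y]]]] := path_exit b0s b0B zB.
  have /connectP[s' ys' Db0] := strC y b0 yC b0C; rewrite Db0 in b0B.
  have [q [yq qB [b2 b2B /and3P[_ _ qb2]]]] := path_first_entry ys' yB b0B.
  exists (size q); apply/asboolP; exists y, q.
  split=> //; [by exists b1 | exact: sub_path yq |].
  by split; [exact: (subsetP sCS) | exists b2].
move/ex_minnP=> [n /asboolP[x [p [Dn [b1 b1B b1x] xp pB [xS [b2 b2B pb2]]]]] minn].
have min_ear m : ear m -> n <= m by move=> em; apply: minn; apply/asboolP.
have pS : {subset x :: p <= S}.
  move=> a; rewrite inE => /predU1P[-> //|ap].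
  have /(connect_restr_in xS) // : connect (restr S) x a.
  by apply: (path_connect xp); rewrite inE ap orbT.
(* An arc from [B] to a later inner vertex would start a shorter ear there. *)
have B_x b a : b \in B -> a \in x :: p -> e b a -> a = x.
  move=> bB; rewrite inE => /predU1P[//|ap] ba.
  have aS : a \in S by apply: pS; rewrite inE ap orbT.
  have [p1 [p2 Dp]] : exists p1 p2, p = p1 ++ a :: p2.
    by case/splitPr: ap => p1 p2; exists p1, p2.
  suff /min_ear : ear (size p2).
    by rewrite -Dn Dp size_cat leqNgt addnS ltnS leq_addl.
  exists a, p2; split=> //; first by exists b.
  - by move: xp; rewrite Dp cat_path => /and3P[].
  - by move: pB; rewrite Dp /= all_cat => /and3P[].
  by split=> //; exists b2 => //; move: pb2; rewrite Dp last_cat.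
(* The block of [Q] containing [x] already receives the arc from [b1]; an arc from [x] back to [B]
   would make it adjacent to [B] in both directions. *)
have x_B b : b \in B -> ~~ e x b.
  move=> bB; apply/negP=> xb; have /bigcupP[B' B'Q xB'] := xS.
  have nBB' : B' != B.
    by apply: contraTneq xB' => ->; case/andP: pB.
  have /negP[] := nadj B' B'Q nBB'.
  by apply/andP; split; apply/adjP; [exists b1, x | exists x, b].
have ear_idx a d : a \in x :: p -> d \in x :: p -> e a d ->
    index d (x :: p) <= (index a (x :: p)).+1.
  move=> ap dp ad; rewrite leqNgt; apply/negP=> lt_ad.
  have [||q [xq ltqp Dq sqp]] :=
    @path_shortcut (restr S) x p (index a (x :: p)) (index d (x :: p)) _ xp.
  - by rewrite lt_ad -ltnS -[(size p).+1]/(size (x :: p)) index_mem.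
  - by rewrite !nth_index //= !pS.
  suff /min_ear : ear (size q) by rewrite -Dn leqNgt ltqp.
  exists x, q; split=> //; first by exists b1.
    by apply/allP=> a' a'q; apply: (allP pB); move: a'q;
      rewrite !inE => /predU1P[->|/sqp->]; rewrite ?eqxx ?orbT.
  by split=> //; exists b2; rewrite ?Dq.
pose X := B :|: [set a in x :: p].
have sBX : B \subset X by exact: subsetUl.
have pX : {subset x :: p <= X} by move=> a ap; rewrite !inE -in_cons ap orbT.
have gX : good X.
  split.
  - by apply/set0Pn; exists x; apply: pX; rewrite mem_head.
  - have xpX : path (restr X) x p.
      apply: path_restr pX; apply: sub_path xp.
      by move=> u v /and3P[].
    have BX u v : u \in B -> v \in B -> connect (restr X) u v.
      by move=> uB vB; apply: connect_restrS sBX _; exact: strB.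
    have b1x' : connect (restr X) b1 x.
      by apply: connect1; rewrite /= b1x (subsetP sBX) // pX ?mem_head.
    have pb2' : connect (restr X) (last x p) b2.
      by apply: connect1; rewrite /= pb2 pX ?mem_last // (subsetP sBX).
    apply: (@strong_hub _ b0) => a; rewrite !inE -in_cons => /orP[aB|ap].
      by split; exact: BX.
    split.
      apply: connect_trans (BX b0 b1 b0B b1B) (connect_trans b1x' _).
      exact: path_connect xpX a ap.
    apply: connect_trans (connect_trans _ pb2') (BX b2 b0 b2B b0B).
    case/splitPl: ap xpX => p1 p2 Da; rewrite cat_path last_cat Da => /andP[_ ap2].
    by apply/connectP; exists p2.
  pose idx a := index a (x :: p).
  exists (fun a => if a \in B then c a else odd (idx a)) => i.
  (* Along arcs within a color class the index on the ear decreases, so it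
     ranks the ear, with [B] inserted between its first vertex, the only one
     receiving arcs from [B], and the others. *)
  have [h acyh] := acyB i; pose M := \max_(b in B) h b.
  exists (fun a => if a \in B then (h a).+1 else
                   if idx a == 0 then 0 else M + (idx a).+2).
  have leM b : b \in B -> h b <= M by move=> bB; exact: leq_bigmax_cond.
  have idx0 a : a \in x :: p -> (idx a == 0) = (a == x).
    by rewrite /idx /= [a == x]eq_sym; case: (x == a).
  move=> u v uX' vX' uv; move: uX' vX'.
  rewrite !inE -!in_cons => /andP[uX cu] /andP[vX cv].
  case: ifPn vX cv => [vB _|vB /= vp] cv; case: ifPn uX cu => [uB _|uB /= up] cu.
  - by rewrite ltnS; apply: acyh; rewrite ?inE ?uB ?vB ?cu ?cv.
  - rewrite idx0 //; case: eqP => [ux|_].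
      by have:= x_B v vB; rewrite -ux uv.
    by rewrite !addnS !ltnS (leq_trans (leM v vB)) ?leq_addr.
  - by rewrite idx0 // (B_x u v) // eqxx.
  have le_vu := ear_idx u v up vp uv.
  have ne_vu : idx v != idx u.
    apply: contraTneq uv => /(congr1 (nth x (x :: p))).
    by rewrite !nth_index // => ->; rewrite e_irr.
  have ne_vu1 : idx v != (idx u).+1.
    (* Consecutive ear vertices have opposite parity, hence different colors. *)
    by apply/eqP=> Dv; move: cu cv; rewrite Dv /= => /eqP <- /eqP; case: (odd _).
  rewrite -/(idx u) -/(idx v) in le_vu.
  have lt_vu : idx v < idx u by rewrite ltn_neqAle ne_vu -ltnS ltn_neqAle ne_vu1.
  rewrite (gtn_eqF (leq_ltn_trans (leq0n _) lt_vu)).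
  by case: eqP => _; [rewrite addnS | rewrite ltn_add2l !ltnS].
have pX0 : X \subset S.
  by rewrite subUset sBS; apply/subsetP=> a; rewrite inE; exact: pS.
have /subsetP/(_ x) := maxB X gX sBX pX0.
by case/andP: pB => /negPf /= -> _; apply; apply: pX; rewrite mem_head.
Qed.

End StrongSets.

Arguments restr {T} e A x y /.

(** * From rank functions to acyclic subdigraphs and dicolorings *)

Lemma acyc_acyclic (D : digraph) (A : {set D}) :
  acyc (@darc D) A -> acyclic (dinduced A).
Proof.
case=> h hA; case=> // x c /andP[/= xc _]; exfalso.
have ltp (y : dinduced A) s : s != [::] -> path (@darc (dinduced A)) y s ->
    h (val (last y s)) < h (val y).
  elim: s y => // z s IHs y _ /= /andP[yz zs].
  have lt_zy := hA _ _ (valP y) (valP z) yz.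
  by case: s zs IHs => // w s zs /(_ z isT zs)/ltn_trans->.
have ntc : rcons c x != [::] by case: (c).
by have := ltp x _ ntc xc; rewrite last_rcons ltnn.
Qed.

(** Colors from an arbitrary finite type allow pairs made of a block color and a color inside the
    block. *)
Lemma acyc_dicolorable (D : digraph) (K : finType) (c : D -> K) :
  (forall i, acyc (@darc D) [set x | c x == i]) -> dicolorable D #|K|.
Proof.
move=> acyc_c; exists (enum_rank \o c) => i; apply: acyc_acyclic.
apply: acycS (acyc_c (enum_val i)); apply/subsetP=> x; rewrite !inE /=.
by move/eqP=> <-; rewrite enum_rankK.
Qed.

(** * The undirected graph on the blocks *)

Section BlockGraph.

Variables (D : digraph) (P : {set {set D}}).

Definition block_edge : rel {B : {set D} | B \in P} :=
  [rel A B | [&& A != B, adj (@darc D) (val A) (val B)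
                       & adj (@darc D) (val B) (val A)]].

Fact block_edge_sym : symmetric block_edge.
Proof. by move=> A B; rewrite /block_edge /= eq_sym [X in _ && X]andbC. Qed.

Fact block_edge_irr : irreflexive block_edge.
Proof. by move=> A; rewrite /block_edge /= eqxx. Qed.

Definition block_graph : sgraph := SGraph block_edge_sym block_edge_irr.

Hypothesis parP : partition P setT.

(** Each vertex gets the color of its block paired with its own color in a 2-dicoloring of that
    block. A class that is not acyclic contains a strong set [C] with two vertices; the blocks met
    by [C] share a color, so they are pairwise non-adjacent, and [C] falls into one block, where its
    color class is acyclic. *)
Lemma block_graph_dicolorable k :
    (forall Q : {set {set D}}, Q \subset P -> Q != set0 ->
      exists2 B, B \in Q & max_good (@darc D) (cover Q) B) ->
  colorable block_graph k -> dicolorable D (k * 2).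
Proof.
move=> maxP [f fP].
have coverP x : x \in cover P by rewrite (cover_partition parP).
have tiP := partition_trivIset parP.
pose blk x : block_graph := Sub (pblock P x) (pblock_mem (coverP x)).
have blkE (B : block_graph) x : x \in val B -> blk x = B.
  by move=> xB; apply: val_inj; rewrite /=; apply: def_pblock => //; exact: valP B.
have [c cP] : {c : block_graph -> D -> bool & forall (B : block_graph) i,
    acyc (@darc D) [set x in val B | c B x == i]}.
  apply: (@choice block_graph (D -> bool) (fun B c => forall i,
    acyc (@darc D) [set x in val B | c x == i])) => B.
  (* For the one-element family, [maxP] says that the block itself is good. *)
  have [||B'] := maxP [set val B].
  - by rewrite sub1set (valP B).
  - by apply/set0Pn; exists (val B); rewrite inE.
  by rewrite inE => /eqP-> [[]].
have -> : k * 2 = #|{: 'I_k * bool}| by rewrite card_prod card_ord card_bool.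
apply: (@acyc_dicolorable _ _ (fun x => (f (blk x), c (blk x) x))) => -[i j].
apply: contrapT => /(acycPn (@darc_irr D)) [C [sCij strC [x [y [xC yC]]]]] /eqP; apply.
have Cij z : z \in C -> f (blk z) = i /\ c (blk z) z = j.
  by move/(subsetP sCij); rewrite inE => /eqP[-> ->].
pose Q := [set B in P | ~~ [disjoint B & C]].
have pbQ z : z \in C -> pblock P z \in Q.
  move=> zC; rewrite inE pblock_mem //=; apply/pred0Pn; exists z.
  by rewrite /= mem_pblock coverP.
have [||B] := maxP Q.
- by apply/subsetP=> B; rewrite inE => /andP[].
- by apply/set0Pn; exists (pblock P x); exact: pbQ.
rewrite inE => /andP[BP BC] maxB; pose B1 : block_graph := Sub B BP.
have /subsetP sCB : C \subset B.
  apply: (strong_sub_max_good (@darc_irr D) maxB) => //; last first.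
    apply/subsetP=> z zC; apply/bigcupP; exists (pblock P z); first exact: pbQ.
    by rewrite mem_pblock.
  move=> B'; rewrite inE => /andP[B'P B'C] neB; pose B2 : block_graph := Sub B' B'P.
  have fC (A : block_graph) : ~~ [disjoint val A & C] -> f A = i.
    by case/pred0Pn=> z /andP[/= zA /Cij[]]; rewrite (blkE A).
  apply/negP=> adjB; have := fP B1 B2; rewrite !fC // eqxx.
  suff -> : edge B1 B2 by move/(_ isT).
  by rewrite /= /block_edge /= adjB andbT -val_eqE /= eq_sym.
apply: (strong_acyc strC) xC yC; apply: acycS (cP B1 j).
apply/subsetP=> z zC; have [_] := Cij z zC; have zB := sCB z zC.
by rewrite inE /= zB (blkE B1) // => /eqP.
Qed.

(** Branch sets of blocks are replaced by the unions of their blocks. An edge of the block graph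
    stands for arcs in both directions, as the bidirected complete graph requires. *)
Lemma block_graph_minor t :
    (forall B, B \in P -> strong (@darc D) B) ->
    contains_minor block_graph (complete t) ->
  contains_strong_minor D (bidirected (complete t)).
Proof.
move=> strP [X [ntX disX conX adjX]].
pose Y v := \bigcup_(B in X v) val B.
have disP (A B : block_graph) x : x \in val A -> x \in val B -> A = B.
  move=> xA xB; have tiP := partition_trivIset parP; apply: val_inj.
  by rewrite -(def_pblock tiP (valP A) xA) (def_pblock tiP (valP B) xB).
have strY v : strong (@darc D) (Y v).
  apply: (@strong_bigcup _ _ _ (@edge block_graph)).
  - move=> A B AX BX; have := conX v (Sub A AX) (Sub B BX).
    exact: connect_restr_val.
  - by move=> B _; apply: strP; exact: valP B.
  by move=> A B /and3P[_ /adjP].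
(* The branch sets of a model must cover it, so the subdigraph taken is the one induced on their
   union. *)
pose W := \bigcup_v Y v.
have sYW v : {subset Y v <= W} by apply/subsetP; exact: bigcup_sup.
exists (dinduced W); first by exists val => //; exact: val_inj.
pose Z v := [set z : dinduced W | val z \in Y v].
exists Z; split; first split.
- move=> v; have /set0Pn[B BX] := ntX v.
  have /set0Pn[x xB] := partition_neq0 parP (valP B).
  have xY : x \in Y v by apply/bigcupP; exists B.
  by apply/set0Pn; exists (Sub x (sYW v x xY)); rewrite inE.
- move=> u v /disX/pred0P disuv; apply/pred0P=> z /=; rewrite !inE.
  apply/negP=> /andP[/bigcupP[A AX zA] /bigcupP[B BX zB]].
  by have := disuv A; rewrite /= AX (disP A B _ zA zB) BX.
- apply/setP=> z; rewrite inE; have /bigcupP[v _ zY] := valP z.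
  by apply/bigcupP; exists v => //; rewrite inE.
- move=> v a b.
  (* Vertices here lie in a subtype of a subtype of [D], whence the double [val]. *)
  apply: (@connect_lift _ (@darc D) _ (fun z => val (val z)) (Y v)).
  + by move=> a' b' /val_inj/val_inj.
  + move=> x xY; have xZ : Sub x (sYW v x xY) \in Z v by rewrite inE.
    by exists (exist (fun z => z \in Z v) _ xZ).
  by apply: strY; [have := valP a | have := valP b]; rewrite inE.
move=> u v /adjX[A [B [AX BX /and3P[_ /adjP[x [y [xA yB xy]]] _]]]].
have xY : x \in Y u by apply/bigcupP; exists A.
have yY : y \in Y v by apply/bigcupP; exists B.
exists (Sub x (sYW u x xY)), (Sub y (sYW v y yY)).
by rewrite !inE.
Qed.

End BlockGraph.

Lemma strong_minor_of_minor t m :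
    0 < m ->
    (forall G : sgraph, m <= chromatic_number G -> contains_minor G (complete t)) ->
  forall D : digraph, 2 * m - 1 <= dichromatic_number D ->
    contains_strong_minor D (bidirected (complete t)).
Proof.
move=> m_gt0 minorG D leD.
have [P [parP maxP]] := greedy_partition (@darc_irr D) setT.
apply: (@block_graph_minor _ P parP) => [B BP|].
  have [||B'] := maxP [set B]; first by rewrite sub1set.
    by apply/set0Pn; exists B; rewrite inE.
  by rewrite inE => /eqP-> [[]].
apply: minorG; rewrite /chromatic_number; case: ex_minnP => k /asboolP colk _.
have colD := block_graph_dicolorable parP maxP colk.
move: leD; rewrite /dichromatic_number; case: ex_minnP => d _ /(_ (k * 2)).
(* With [k] the chromatic number of the block graph, [2 * m - 1 <= d <= 2 * k] forces [m <= k] by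
   parity. *)
by move/(_ (asboolT colD)); lia.
Qed.

(** * Clique minors in graphs of large chromatic number *)

Section CliqueMinor.

Variables (T : finType) (e : rel T).
Hypotheses (e_sym : symmetric e) (e_irr : irreflexive e).

Definition coloring (A : {set T}) (k : nat) (f : T -> nat) : Prop :=
  {in A, forall x, f x < k} /\ {in A &, forall x y, e x y -> f x != f y}.

Definition colorable_on (A : {set T}) (k : nat) : Prop :=
  exists f, coloring A k f.

Definition clique_minor_in (A : {set T}) (t : nat) : Prop :=
  exists X : nat -> {set T},
    (forall i, i < t -> [/\ X i != set0, X i \subset A & strong e (X i)]) /\
    (forall i j, i < j < t -> [disjoint X i & X j] /\ adj e (X i) (X j)).

Lemma connect_restr_sym (A : {set T}) x y :
  connect (restr e A) x y = connect (restr e A) y x.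
Proof.
apply: sym_connect_sym => {x y} x y.
by rewrite /restr e_sym; case: (x \in A); case: (y \in A).
Qed.

(** Adjacent vertices have the same component as a set, so one coloring chosen for that set handles
    both. *)
Lemma colorable_on_components (A : {set T}) k :
    (forall C : {set T}, C \subset A -> strong e C -> colorable_on C k) ->
  colorable_on A k.
Proof.
move=> colC; pose comp x :=
  [set z in A | connect (restr e A) x z && connect (restr e A) z x].
have /choice[F FP] : forall C : {set T}, exists f,
    C \subset A -> strong e C -> coloring C k f.
  move=> C; have [[CA strC]|CA] := pselect (C \subset A /\ strong e C).
    by have [f fC] := colC C CA strC; exists f.
  by exists (fun=> 0) => sCA strC; case: CA.
have compP x : coloring (comp x) k (F (comp x)).
  by apply: FP; [apply/subsetP=> z; rewrite inE => /andP[] | exact: strong_component].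
have comp_id x : x \in A -> x \in comp x by move=> xA; rewrite inE xA connect0.
exists (fun x => F (comp x) x); split=> [x xA|x y xA yA xy].
  by have [+ _] := compP x; apply; exact: comp_id.
have cxy : connect (restr e A) x y by apply: connect1; rewrite /= xA yA.
have cyx : connect (restr e A) y x by rewrite connect_restr_sym.
have Dxy : comp x = comp y.
  apply/setP=> z; rewrite !inE; congr [&& _, _ & _].
    by apply/idP/idP; exact: connect_trans.
  by apply/idP/idP => zc; exact: connect_trans zc _.
rewrite Dxy; have [_] := compP y; apply=> //; last exact: comp_id.
by rewrite -Dxy comp_id.
Qed.

(** [d x] is the length of a shortest walk from [r] to [x] inside [C], and 0 outside [C] may be
    taken as a default. *)
Lemma distance_exists (C : {set T}) r : strong e C -> r \in C ->
  exists d : T -> nat, [/\ {in C, forall x, (d x == 0) = (x == r)},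
    {in C &, forall x y, e x y -> d y <= (d x).+1} &
    {in C, forall x, 0 < d x -> exists y, [/\ y \in C, e y x & d y < d x]}].
Proof.
move=> strC rC.
pose walk x n := exists s, [/\ path (restr e C) r s, last r s = x & size s = n].
have /choice[d dP] : forall x, exists n,
    x \in C -> walk x n /\ forall m, walk x m -> n <= m.
  move=> x; have [xC|xC] := boolP (x \in C); last by exists 0.
  have : exists n, `[< walk x n >].
    have /connectP[s rs Dx] := strC r x rC xC.
    by exists (size s); apply/asboolP; exists s.
  by case/ex_minnP=> n /asboolP wn minn; exists n => _; split=> // m /asboolP/minn.
exists d; split.
- move=> x xC; have [[s [_ + sz]] mind] := dP x xC.
  rewrite -sz; case: s sz => [|y s] sz /=; first by rewrite eq_sym => /eqP.
  move=> _; apply/esym/eqP=> Dx.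
  suff /mind : walk x 0 by rewrite -sz.
  by exists [::].
- move=> x y xC yC xy; have [[s [rs Dx sz]] _] := dP x xC.
  have [_ ->//] := dP y yC; exists (rcons s y).
  by rewrite rcons_path last_rcons size_rcons rs Dx sz /= xC yC.
move=> x xC; have [[s [+ + <-]] _] := dP x xC.
case/lastP: s => // s z; rewrite rcons_path last_rcons size_rcons.
case/andP=> rs /and3P[yC zC yz] Dz _; exists (last r s); split=> //.
  by rewrite -Dz.
by rewrite ltnS; have [_] := dP _ yC; apply; exists s.
Qed.

(** Adjacent vertices lie in the same or in consecutive layers, so two disjoint palettes of [k]
    colors, alternating with the parity of the layer, suffice. *)
Lemma colorable_on_layers (C : {set T}) (d : T -> nat) k :
    {in C &, forall x y, e x y -> d y <= (d x).+1} ->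
    (forall n, colorable_on [set x in C | d x == n] k) ->
  colorable_on C (2 * k).
Proof.
move=> dP /choice[F FP].
have FL x : x \in C -> F (d x) x < k.
  by move=> xC; have [+ _] := FP (d x); apply; rewrite inE xC eqxx.
exists (fun x => odd (d x) * k + F (d x) x); split=> [x xC|x y xC yC xy].
  by have := FL x xC; case: (odd _) => /=; lia.
have le_yx := dP x y xC yC xy; have := dP y x yC xC; rewrite e_sym => /(_ xy) le_xy.
have [Dd|nd] := eqVneq (d x) (d y).
  rewrite Dd eqn_add2l; have [_] := FP (d y).
  by apply=> //; rewrite inE ?xC ?yC ?Dd eqxx.
have nodd : odd (d x) != odd (d y).
  have [->|->] : d x = (d y).+1 \/ d y = (d x).+1 by move: nd le_yx le_xy; clear; lia.
    by rewrite /=; case: (odd _).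
  by rewrite /=; case: (odd _).
have := FL x xC; have := FL y yC; move: nodd; clear.
by case: (odd _); case: (odd _) => //= _; lia.
Qed.

(** By induction on [t]: some component needs more than [2 ^ t.+1] colors, so one of its distance
    layers needs more than [2 ^ t]. The clique minor found in that layer gains one more branch set,
    the ball [B] of vertices nearer to the root. *)
Lemma clique_minor_exists (A : {set T}) t :
  ~ colorable_on A (2 ^ t) -> clique_minor_in A t.+1.
Proof.
elim: t A => [|t IHt] A ncol.
  have [A0|/set0Pn[x xA]] := eqVneq A set0.
    by case: ncol; exists (fun=> 0); rewrite A0; split=> x; rewrite inE.
  exists (fun=> [set x]); split; last by move=> i [|j]; rewrite ?ltnS ltn0 ?andbF.
  move=> i _; split; [|by rewrite sub1set|exact: strong1].
  by apply/set0Pn; exists x; rewrite inE.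
have [C [sCA strC ncolC]] : exists C : {set T},
    [/\ C \subset A, strong e C & ~ colorable_on C (2 ^ t.+1)].
  apply: contrapT => noC; apply: ncol; apply: colorable_on_components => C sCA strC.
  by apply: contrapT => ncol; apply: noC; exists C.
have [C0|/set0Pn[r rC]] := eqVneq C set0.
  by case: ncolC; exists (fun=> 0); rewrite C0; split=> x; rewrite inE.
have [d [d0 d1 dS]] := distance_exists strC rC.
have [n ncolL] : exists n, ~ colorable_on [set x in C | d x == n] (2 ^ t).
  apply: contrapT => noL; apply: ncolC; rewrite expnS.
  apply: (colorable_on_layers d1) => n; apply: contrapT => ncolLn.
  by apply: noL; exists n.
(* Layer 0 is just the root and takes a single color; so [n] is positive and the ball contains the
   root. *)
have n_gt0 : 0 < n.
  rewrite lt0n; apply/eqP=> n0; apply: ncolL; exists (fun=> 0).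
  split=> [x _|x y]; first by rewrite expn_gt0.
  rewrite !inE n0 => /andP[xC]; rewrite d0 // => /eqP-> /andP[yC].
  by rewrite d0 // => /eqP->; rewrite e_irr.
have [X [XP XX]] := IHt _ ncolL.
pose B := [set x in C | d x < n].
have rB x : x \in B -> connect (restr e B) r x.
  have [m] := ubnP (d x); elim: m x => // m IHm x; rewrite ltnS => lem xB.
  have := xB; rewrite inE => /andP[xC ltxn].
  have [/eqP|] := posnP (d x); first by rewrite d0 // => /eqP->; exact: connect0.
  case/(dS x xC)=> y [yC yx ltyx].
  have yB : y \in B by rewrite inE yC (ltn_trans ltyx).
  apply: connect_trans (IHm y (leq_trans ltyx lem) yB) _.
  by apply: connect1; rewrite /= yB xB.
have d_r : d r < n.
  by rewrite (leq_trans _ n_gt0) // ltnS leqn0 d0.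
have strB : strong e B.
  apply: (@strong_hub _ _ _ r) => x xB.
  by rewrite [connect _ x r]connect_restr_sym; split; exact: rB.
exists (fun i => if i == t.+1 then B else X i); split.
  move=> i; rewrite ltnS leq_eqVlt; case: eqP => [_ _|_ /= lti].
    split=> //; first by apply/set0Pn; exists r; rewrite inE rC.
    by apply: subset_trans sCA; apply/subsetP=> x; rewrite inE => /andP[].
  have [ntX sX strX] := XP i lti; split=> //.
  apply: subset_trans sX (subset_trans _ sCA).
  by apply/subsetP=> x; rewrite inE => /andP[].
move=> i j /andP[ltij]; rewrite ltnS leq_eqVlt => /predU1P[Dj|ltj].
  have lti : i < t.+1 by rewrite -Dj.
  rewrite Dj eqxx ltn_eqF //; have [/set0Pn[x xX] /subsetP sX _] := XP i lti.
  split.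
    apply/pred0P=> y /=; apply/negP=> /andP[/sX]; rewrite !inE.
    by move=> /andP[_ /eqP->]; rewrite ltnn andbF.
  have := sX x xX; rewrite inE => /andP[xC /eqP Dn].
  (* Every vertex of layer [n] has a neighbor nearer to the root, which lies in the ball. *)
  have [|y [yC yx ltyx]] := dS x xC; first by rewrite Dn.
  by apply/adjP; exists x, y; rewrite inE yC -Dn e_sym.
by rewrite !ltn_eqF ?(ltn_trans ltij) //; apply: XX; rewrite ltij.
Qed.

End CliqueMinor.

(** * Existence of the two numbers and the final bound *)

Lemma clique_minor_contains_minor (G : sgraph) t :
  clique_minor_in (@edge G) setT t -> contains_minor G (complete t).
Proof.
case=> X [XP XX]; exists (fun i : 'I_t => X i); split.
- by move=> v; have [] := XP v (ltn_ord v).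
- move=> u v; rewrite -val_eqE /= neq_ltn => /orP[ltuv|ltvu].
    by have [|] := XX u v; first by rewrite ltuv ltn_ord.
  by rewrite disjoint_sym; have [|] := XX v u; first by rewrite ltvu ltn_ord.
- move=> v a b; have [_ _ strX] := XP v (ltn_ord v).
  apply: (@connect_lift _ (@edge G) _ val (X v)); first exact: val_inj.
    by move=> x xX; exists (exist (fun z => z \in X v) x xX).
  by apply: strX; exact: valP.
move=> u v; rewrite /= /Kedge /= -val_eqE /= neq_ltn => /orP[ltuv|ltvu].
  by have [|_ /adjP] := XX u v; first by rewrite ltuv ltn_ord.
have [|_ /adjP[x [y [xX yX xy]]]] := XX v u; first by rewrite ltvu ltn_ord.
by exists y, x; rewrite edge_sym.
Qed.

Lemma complete_minor_of_chromatic_number (G : sgraph) t :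
  2 ^ t < chromatic_number G -> contains_minor G (complete t.+1).
Proof.
rewrite /chromatic_number; case: ex_minnP => k _ mink ltk.
apply: clique_minor_contains_minor; apply: clique_minor_exists.
- exact: edge_sym.
- exact: edge_irr.
case=> f [ltf fP]; move: ltk; rewrite ltnNge mink //; apply/asboolP.
exists (fun x => Ordinal (ltf x (in_setT x))) => x y xy.
by rewrite -val_eqE /= fP ?inE.
Qed.

Lemma least_positive_exists (P : nat -> Prop) n : 0 < n -> P n ->
  exists2 m, least_positive P m & m <= n.
Proof.
move=> n_gt0 Pn; have exP : exists m, (0 < m) && `[< P m >].
  by exists n; rewrite n_gt0; apply/asboolP.
case: (ex_minnP exP) => m /andP[m_gt0 /asboolP Pm] minm; exists m.
  by split=> // k k_gt0 Pk; apply: minm; rewrite k_gt0; apply/asboolP.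
by apply: minm; rewrite n_gt0; apply/asboolP.
Qed.

Theorem theorem1 (t : nat) (ht : 1 <= t) :
  exists m s : nat, [/\ is_m_chi t m, is_sm_dichi t s & s <= 2 * m - 1].
Proof.
case: t ht => // t _.
have [m mP _] : exists2 m, is_m_chi t.+1 m & m <= (2 ^ t).+1.
  apply: least_positive_exists => // G; exact: complete_minor_of_chromatic_number.
have [m_gt0 minor_m _] := mP.
have [s sP les] : exists2 s, is_sm_dichi t.+1 s & s <= 2 * m - 1.
  apply: least_positive_exists; first by lia.
  exact: strong_minor_of_minor m_gt0 minor_m.
by exists m, s.
Qed.
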